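(* Let $G$ be a graph of order $n_0$ and size $m_0$, and let $k\ge 1$. Suppose $\mathcal{L}^k(G)$ has property $\varrho$ and the multiplicity of $-2$ as an eigenvalue of $\mathcal{L}^k(G)$ is $m_{k-1}-n_{k-1}$. Then $Ebd(\mathcal{L}^k(G))$ and $Ebd(\overline{\mathcal{L}^k(G)})$ are equienergetic if and only if $\overline{\lambda}_{k(1)}=n^-(\overline{\mathcal{L}^k(G)})$.
   Context: $\mathcal{L}^k(G)$ is the $k$-th iterated line graph, of order $n_k$ and size $m_k$; $\overline{X}$ is the complement; $\overline{\lambda}_{k(1)}$ is the largest adjacency eigenvalue of $\overline{\mathcal{L}^k(G)}$; $n^-(X)$ is the number of negative adjacency eigenvalues of $X$. Property $\varrho$: all negative adjacency eigenvalues equal $-2$. $Ebd(X)$ (extended bipartite double) has parts $\{x_i\},\{y_i\}$ indexed by vertices $v_i$ of $X$, with $x_i\sim y_j$ iff $i=j$ or $v_iv_j\in E(X)$. Energy is the sum of absolute values of adjacency eigenvalues. *)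

(* Defs.v *)
From HB Require Import structures.
From mathcomp Require Import all_boot all_order all_algebra all_field.

Set Implicit Arguments.
Unset Strict Implicit.
Unset Printing Implicit Defensive.

Import Order.TTheory GRing.Theory Num.Theory.
Local Open Scope ring_scope.

Record sgraph := SGraph {
  vertex :> finType;
  adj : rel vertex;
  adj_sym : symmetric adj;
  adj_irr : irreflexive adj
}.

Definition edges (G : sgraph) : {set {set G}} :=
  [set e : {set G} | [exists x : G, exists y : G, adj x y && (e == [set x; y])]].

Definition gorder (G : sgraph) : nat := #|G|.
Definition gsize (G : sgraph) : nat := #|edges G|.

Definition line_vertex (G : sgraph) : finType := {e : {set G} | e \in edges G}.

Definition line_adj (G : sgraph) : rel (line_vertex G) :=
  fun e f => (e != f) && (val e :&: val f != set0).

Lemma line_adj_sym G : symmetric (@line_adj G).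
Proof. by move=> e f; rewrite /line_adj eq_sym setIC. Qed.

Lemma line_adj_irr G : irreflexive (@line_adj G).
Proof. by move=> e; rewrite /line_adj eqxx. Qed.

Definition line_graph (G : sgraph) : sgraph :=
  SGraph (@line_adj_sym G) (@line_adj_irr G).

Definition iter_line_graph (k : nat) (G : sgraph) : sgraph :=
  iter k line_graph G.

Definition compl_adj (G : sgraph) : rel G :=
  fun x y => (x != y) && ~~ adj x y.

Lemma compl_adj_sym G : symmetric (@compl_adj G).
Proof. by move=> x y; rewrite /compl_adj eq_sym adj_sym. Qed.

Lemma compl_adj_irr G : irreflexive (@compl_adj G).
Proof. by move=> x; rewrite /compl_adj eqxx. Qed.

Definition compl_graph (G : sgraph) : sgraph :=
  SGraph (@compl_adj_sym G) (@compl_adj_irr G).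

(* The parts {x_i} and {y_i} are the left and right copies of the vertices. *)
Definition ebd_adj (G : sgraph) : rel (G + G)%type :=
  fun u v => match u, v with
  | inl x, inr y | inr y, inl x => (x == y) || adj x y
  | _, _ => false
  end.

Lemma ebd_adj_sym G : symmetric (@ebd_adj G).
Proof. by move=> [x|x] [y|y]. Qed.

Lemma ebd_adj_irr G : irreflexive (@ebd_adj G).
Proof. by move=> [x|x]. Qed.

Definition Ebd (G : sgraph) : sgraph :=
  SGraph (@ebd_adj_sym G) (@ebd_adj_irr G).

Definition adjmx (G : sgraph) : 'M[algC]_(gorder G) :=
  \matrix_(i, j) (adj (enum_val i) (enum_val j))%:R.

(* The eigenvalues listed with multiplicity, as the roots of the              *)
(* characteristic polynomial. The matrix being integral and symmetric, they   *)
(* are real algebraic numbers, so the order of algC is total on them.         *)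
Definition eigenvalues (G : sgraph) : seq algC :=
  sval (closed_field_poly_normal (char_poly (adjmx G))).

(* Equal to 0 for the graph without vertices. *)
Definition largest_eigenvalue (G : sgraph) : algC :=
  \big[Num.max/head 0 (eigenvalues G)]_(x <- eigenvalues G) x.

Definition eigenvalue_mult (G : sgraph) (a : algC) : nat :=
  count_mem a (eigenvalues G).

Definition num_neg_eigenvalues (G : sgraph) : nat :=
  count (fun x : algC => x < 0) (eigenvalues G).

Definition property_rho (G : sgraph) : Prop :=
  forall x : algC, x \in eigenvalues G -> x < 0 -> x = -2.

Definition energy (G : sgraph) : algC := \sum_(x <- eigenvalues G) `|x|.

Definition equienergetic (G H : sgraph) : Prop :=
  gorder G = gorder H /\ energy G = energy H.

(* Main.v *)
(* Let A be the adjacency matrix of H = L^k(G), of order N, and let q be the   *)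
(* multiplicity of -2. Ebd(X) has the eigenvalues x + 1 and -(x + 1) for x in  *)
(* the spectrum of X, so its energy is 2 sum |x + 1|. As H is a line graph,    *)
(* A + 2 = B B^T for the incidence matrix B, whose rows sum to 2; hence the    *)
(* eigenvectors for -2 are orthogonal to the constant vector. Comparing        *)
(* quadratic forms, the spectrum of the complement J - 1 - A then consists of  *)
(* q times 1, one more eigenvalue b >= 0, and N - q - 1 eigenvalues <= -1.     *)
(* All traces vanish, so the two energies agree iff b = N - q - 1, which is    *)
(* the number of negative eigenvalues of the complement. Finally b is the      *)
(* largest eigenvalue unless q > 0 and b < 1, and then N - q, the order of     *)
(* L^(k-1)(G), is at least 3, so that neither 1 nor b equals N - q - 1.        *)

Require Import Defs.
From HB Require Import structures.
From mathcomp Require Import all_boot all_order all_algebra all_field.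
From mathcomp Require Import spectral sesquilinear ring.

Set Implicit Arguments.
Unset Strict Implicit.
Unset Printing Implicit Defensive.

Import Order.TTheory GRing.Theory Num.Theory.
Local Open Scope ring_scope.
Local Open Scope sesquilinear_scope.

(** Both energies reduce to a few spectral data. The double of a graph has energy 2 sum |x + 1|
    ([energy_Ebd]), and traces vanish, so for H = L^k(G), of order N and with -2 of multiplicity q,
    the value is 2(N + 2q) by [energy_Ebd_rho]. [compl_eigenvalues] gives the complement the
    spectrum b, q ones and a list r of numbers at most -1, with N = q + |r| + 1; its double has
    energy 2(2b + 1 + 3q - |r|) by [energy_Ebd_spectrum_ones]. The difference is 4(b - |r|), and |r|
    counts the negative eigenvalues. That shape of the spectrum rests on
    [line_graph_eigenspace_ortho] and on the min-max bounds [inertia_ge] and [inertia_le]. The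
    multiplicity hypothesis makes |r| + 1 the order of L^(k-1)(G), which settles the case where b is
    not the largest eigenvalue. *)

(** * Characteristic polynomials under similarity *)

Lemma char_poly_similar (R : comNzRingType) (m n : nat) (eq_mn : m = n)
    (V : 'M[R]_(m, n)) (W : 'M_(n, m)) (A : 'M_n) :
  V *m W = 1%:M -> char_poly (V *m A *m W) = char_poly A.
Proof.
case: n / eq_mn V W A => V W A VW1; rewrite /char_poly /char_poly_mx.
set p := polyC.
have VW1p : map_mx p V *m map_mx p W = 1%:M by rewrite -map_mxM VW1 map_mx1.
have -> : 'X%:M - map_mx p (V *m A *m W)
        = map_mx p V *m ('X%:M - map_mx p A) *m map_mx p W.
  rewrite mulmxBr mulmxBl !map_mxM scalar_mxC -(mulmxA _ (map_mx p V)) VW1p.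
  by rewrite mulmx1.
by rewrite !det_mulmx mulrAC -det_mulmx VW1p det1 mul1r.
Qed.

Lemma char_poly_relabel (R : comNzRingType) (m n : nat)
    (h : 'I_m -> 'I_n) (A : 'M[R]_n) :
  bijective h -> char_poly (mxsub h h A) = char_poly A.
Proof.
move=> bij_h; have eq_mn : m = n by have := bij_eq_card bij_h; rewrite !card_ord.
pose V : 'M[R]_(m, n) := rowsub h 1%:M.
rewrite -(@char_poly_similar _ _ _ eq_mn V V^T); last first.
  apply/matrixP=> i j; rewrite /V trmx_mxsub trmx1 mul_rowsub_mx mul1mx !mxE.
  by rewrite (inj_eq (bij_inj bij_h)).
by rewrite /V mul_rowsub_mx mul1mx trmx_mxsub trmx1 mulmx_colsub mulmx1 -mxsub_comp.
Qed.

(** Conjugation by a block transvection makes the matrix block lower triangular, with diagonal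
    blocks B and -B. *)
Lemma char_poly_off_diag_block (R : comNzRingType) (n : nat) (B : 'M[R]_n) :
  char_poly (block_mx 0 B B 0) = char_poly B * char_poly (- B).
Proof.
pose V := block_mx 1%:M 1%:M 0 1%:M : 'M[R]_(n + n).
pose W := block_mx 1%:M (- 1%:M) 0 1%:M : 'M[R]_(n + n).
rewrite -(@char_poly_similar _ _ _ erefl V W); last first.
  rewrite mulmx_block ?mulmx1 ?mul1mx ?mulmx0 ?mul0mx ?addr0 ?add0r addNr.
  by rewrite -scalar_mx_block.
rewrite !mulmx_block ?mulmx1 ?mul1mx ?mulmx0 ?mul0mx ?addr0 ?add0r.
rewrite !mulmxN !mulmx1 ?addNr ?addr0.
rewrite /char_poly /char_poly_mx map_block_mx scalar_mx_block opp_block_mx.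
by rewrite add_block_mx map_mx0 subr0 det_lblock.
Qed.

(** * Ranks, forms and eigenspaces of unitarily diagonalized matrices *)

Lemma mxrank_diag_leq (F : fieldType) (n : nat) (d : 'rV[F]_n) :
  (\rank (diag_mx d) <= #|[pred i | (d 0 i != 0)%R]|)%N.
Proof.
rewrite diag_mx_sum_delta -sum1_card [leqRHS]big_mkcond /=.
apply: (big_ind2 (fun (M : 'M[F]_n) k => (\rank M <= k)%N))
  => [|A k B l rA rB|i _]; first by rewrite mxrank0.
  exact: leq_trans (mxrank_add _ _) (leq_add rA rB).
rewrite inE; have [->|_] /= := eqVneq; first by rewrite scale0r mxrank0.
by rewrite (leq_trans (mxrank_scale _ _)) ?mxrank_delta.
Qed.

(** For the lower bound, adding the indicator of the zero entries gives an invertible matrix, and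
    rank is subadditive. *)
Lemma mxrank_diag (F : fieldType) (n : nat) (d : 'rV[F]_n) :
  \rank (diag_mx d) = #|[pred i | (d 0 i != 0)%R]|.
Proof.
apply/eqP; rewrite eqn_leq mxrank_diag_leq /=.
pose e : 'rV[F]_n := \row_i (d 0 i == 0)%:R.
rewrite -(leq_add2r #|[pred i | (d 0 i == 0)%R]|).
have -> : (#|[pred i | (d 0 i != 0)%R]| + #|[pred i | (d 0 i == 0)%R]| = n)%N.
  by rewrite addnC -[RHS]card_ord -(cardC [pred i | (d 0 i == 0)%R]).
have unit_de : diag_mx (d + e) \in unitmx.
  rewrite unitmxE det_diag unitfE prodf_seq_neq0; apply/allP => i _ /=.
  by rewrite !mxE; have [->|] := eqVneq (d 0 i) 0; rewrite ?add0r ?addr0 ?oner_eq0.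
rewrite -{1}(mxrank_unit unit_de) raddfD /= (leq_trans (mxrank_add _ _)) //.
rewrite leq_add2l (leq_trans (mxrank_diag_leq _)) //.
apply/subset_leq_card/subsetP => i; rewrite !inE mxE.
by case: (d 0 i == 0); rewrite ?eqxx.
Qed.

Section UnitaryDiagonalization.

Variables (C : numClosedFieldType) (n : nat) (P : 'M[C]_n) (d : 'rV[C]_n).
Hypothesis unitP : P \is unitarymx.

Let A := P^t* *m diag_mx d *m P.

Lemma unitary_mulVmx : P^t* *m P = 1%:M.
Proof. by rewrite -invmx_unitary // mulVmx // unitarymx_unit. Qed.

Lemma char_poly_unitary_diag : char_poly A = \prod_i ('X - (d 0 i)%:P).
Proof.
rewrite /A char_poly_similar // ?unitary_mulVmx //.
rewrite char_poly_trig ?diag_mx_is_trig //.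
by apply: eq_bigr => i _; rewrite !mxE eqxx.
Qed.

Lemma mxtrace_unitary_diag : \tr A = \sum_i d 0 i.
Proof.
rewrite /A mxtrace_mulC mulmxA.
by have /unitarymxP -> := unitP; rewrite mul1mx mxtrace_diag.
Qed.

Lemma unitary_diag_form (x : 'rV[C]_n) :
  (x *m A *m x^t*) 0 0 = \sum_i d 0 i * `|(x *m P^t*) 0 i| ^+ 2.
Proof.
have -> : x *m A *m x^t* = (x *m P^t*) *m diag_mx d *m (x *m P^t*)^t*.
  by rewrite trmx_mul map_mxM -/(P^t*^t*) trmxCK !mulmxA.
set y := x *m P^t*; rewrite mxE; apply: eq_bigr => i _.
by rewrite mul_mx_diag [y^t* _ _]mxE [y^T _ _]mxE mxE normCK mulrA (mulrC (d 0 i)).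
Qed.

Lemma unitary_norm (x : 'rV[C]_n) :
  (x *m x^t*) 0 0 = \sum_i `|(x *m P^t*) 0 i| ^+ 2.
Proof.
have -> : x *m x^t* = (x *m P^t*) *m (x *m P^t*)^t*.
  by rewrite trmx_mul map_mxM -/(P^t*^t*) trmxCK mulmxA mulmxKtV.
set y := x *m P^t*; rewrite mxE; apply: eq_bigr => i _.
by rewrite [y^t* _ _]mxE [y^T _ _]mxE normCK.
Qed.


Lemma unitary_diag_shift (a : C) :
  A - a%:M = P^t* *m diag_mx (d - const_mx a) *m P.
Proof.
rewrite raddfB /= diag_const_mx mulmxBr mulmxBl -/A; congr (_ - _).
by rewrite scalar_mxC -mulmxA unitary_mulVmx mulmx1.
Qed.

Lemma unitary_diag_row (i : 'I_n) : row i P *m A = d 0 i *: row i P.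
Proof.
rewrite /A !mulmxA -row_mul; have /unitarymxP -> := unitP.
rewrite -row_mul mul1mx -row_mul; apply/rowP => j.
by rewrite mul_diag_mx !mxE.
Qed.

Lemma mxrank_ker_unitary_diag (a : C) :
  \rank (kermx (A - a%:M)) = #|[pred i | (d 0 i == a)%R]|.
Proof.
rewrite unitary_diag_shift mxrank_ker mxrankMfree ?row_free_unit ?unitarymx_unit //.
rewrite eqmxMfull ?row_full_unit ?unitarymx_unit ?trmxC_unitary //.
rewrite mxrank_diag (@eq_card _ _ [predC [pred i | (d 0 i == a)%R]]).
  by rewrite -[X in (X - _)%N]card_ord -(cardC [pred i | (d 0 i == a)%R]) addnK.
by move=> i; rewrite !inE !mxE subr_eq0.
Qed.

End UnitaryDiagonalization.

(** * Eigenvalue counts from quadratic forms on subspaces *)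

(** Half of the Courant-Fischer principle: a larger [U] would contain a nonzero vector without
    component along the eigenvectors of eigenvalue at least [c], and there the form is strictly
    below [c] times the squared norm. *)
Lemma inertia_ge (C : numClosedFieldType) (m n : nat) (P : 'M[C]_n)
    (d : 'rV[C]_n) (U : 'M[C]_(m, n)) (c : C) :
    P \is unitarymx -> c \is Num.real -> (forall i, d 0 i \is Num.real) ->
    (forall x : 'rV_n, (x <= U)%MS ->
       c * (x *m x^t*) 0 0 <= (x *m (P^t* *m diag_mx d *m P) *m x^t*) 0 0) ->
  (\rank U <= #|[pred i | (c <= d 0 i)%R]|)%N.
Proof.
move=> unitP c_real d_real formU; rewrite leqNgt; apply/negP => lt_rank.
pose E : 'rV[C]_n := \row_i (c <= d 0 i)%R%:R.
have rankE : (\rank (diag_mx E) <= #|[pred i | (c <= d 0 i)%R]|)%N.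
  rewrite mxrank_diag; apply/subset_leq_card/subsetP => i.
  by rewrite !inE !mxE; case: (c <= _); rewrite ?eqxx.
have rankUE := leq_trans (mxrankM_maxr (U *m P^t*) (diag_mx E)) rankE.
have : (U :&: kermx (P^t* *m diag_mx E) != 0)%MS.
  rewrite -mxrank_eq0; apply/eqP => cap0.
  move: (mxrank_mul_ker U (P^t* *m diag_mx E)); rewrite cap0 addn0 mulmxA => eqU.
  by move: rankUE; rewrite eqU leqNgt lt_rank.
case/rowV0Pn => x; rewrite sub_capmx => /andP[xU /sub_kermxP].
rewrite mulmxA => xE0 x_neq0.
pose y := x *m P^t*.
have y0 i : c <= d 0 i -> y 0 i = 0.
  move=> cd; move/rowP: xE0 => /(_ i).
  by rewrite mul_mx_diag !mxE cd mulr1.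
have := formU x xU; rewrite (unitary_norm unitP) unitary_diag_form mulr_sumr.
rewrite -subr_le0 -sumrB => sum_le0.
have term_ge0 i : 0 <= c * `|y 0 i| ^+ 2 - d 0 i * `|y 0 i| ^+ 2.
  rewrite -mulrBl; have [cd|dc] := real_leP c_real (d_real i).
    by rewrite y0 // normr0 expr0n mulr0.
  by rewrite mulr_ge0 ?exprn_ge0 // subr_ge0 ltW.
have sum0 : \sum_i (c * `|y 0 i| ^+ 2 - d 0 i * `|y 0 i| ^+ 2) = 0.
  by apply/le_anti; rewrite sum_le0 sumr_ge0.
have yE : y = 0.
  apply/rowP => i; rewrite [RHS]mxE.
  have /eqP : c * `|y 0 i| ^+ 2 - d 0 i * `|y 0 i| ^+ 2 = 0.
    exact: (psumr_eq0P (fun i _ => term_ge0 i) sum0).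
  have [cd|dc] := real_leP c_real (d_real i); first by rewrite y0.
  rewrite -mulrBl mulf_eq0 subr_eq0 gt_eqF //= expf_eq0 /= normr_eq0.
  by move/eqP.
by move: x_neq0; rewrite -(mulmxKtV x unitP erefl) -/y yE mul0mx eqxx.
Qed.

Lemma inertia_le (C : numClosedFieldType) (m n : nat) (P : 'M[C]_n)
    (d : 'rV[C]_n) (U : 'M[C]_(m, n)) (c : C) :
    P \is unitarymx -> c \is Num.real -> (forall i, d 0 i \is Num.real) ->
    (forall x : 'rV_n, (x <= U)%MS ->
       (x *m (P^t* *m diag_mx d *m P) *m x^t*) 0 0 <= c * (x *m x^t*) 0 0) ->
  (\rank U <= #|[pred i | (d 0 i <= c)%R]|)%N.
Proof.
move=> unitP c_real d_real formU.
rewrite (@eq_card _ _ [pred i | (- c <= (- d) 0 i)%R]); last first.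
  by move=> i; rewrite !inE !mxE lerN2.
apply: (inertia_ge unitP) => [|i|x xU]; first by rewrite realN.
  by rewrite mxE realN.
by rewrite raddfN /= mulmxN mulNmx mulmxN mulNmx mulNr [leRHS]mxE lerN2 formU.
Qed.

(** * Spectra of adjacency matrices and of extended bipartite doubles *)

Lemma big_map_enum (R : Type) (idx : R) (op : Monoid.com_law idx)
    (I : finType) (J : Type) (h : I -> J) (F : J -> R) :
  \big[op/idx]_(x <- [seq h i | i <- enum I]) F x = \big[op/idx]_i F (h i).
Proof. by rewrite big_map big_enum. Qed.

Lemma perm_eigenvalues (G : sgraph) (s : seq algC) :
  char_poly (adjmx G) = \prod_(x <- s) ('X - x%:P) -> perm_eq (eigenvalues G) s.
Proof.
move=> charG; apply: prod_XsubC_eq; rewrite -charG /eigenvalues.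
case: closed_field_poly_normal => /= r rE.
by rewrite [RHS]rE (monicP (char_poly_monic _)) scale1r.
Qed.

Lemma adjmx_tr (G : sgraph) : (adjmx G)^T = adjmx G.
Proof. by apply/matrixP => i j; rewrite !mxE adj_sym. Qed.

Lemma adjmx_trC (G : sgraph) : (adjmx G)^t* = adjmx G.
Proof. by apply/matrixP => i j; rewrite !mxE adj_sym conjC_nat. Qed.

Lemma mxtrace_adjmx (G : sgraph) : \tr (adjmx G) = 0.
Proof. by rewrite /mxtrace big1 // => i _; rewrite mxE adj_irr. Qed.

Lemma adjmx_spectral (G : sgraph) :
  exists (P : 'M[algC]_(gorder G)) (d : 'rV[algC]_(gorder G)),
    [/\ P \is unitarymx, forall i, d 0 i \is Num.real,
        adjmx G = P^t* *m diag_mx d *m P &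
        perm_eq (eigenvalues G) [seq d 0 i | i <- enum 'I_(gorder G)]].
Proof.
have hermA : adjmx G \is hermsymmx.
  apply: realsym_hermsym; last by apply/mxOverP => i j; rewrite mxE realn.
  by apply/is_hermitianmxP; rewrite expr0 scale1r map_mx_id // adjmx_tr.
have unitP := spectral_unitarymx (adjmx G).
have defA : adjmx G
    = (spectralmx (adjmx G))^t* *m diag_mx (spectral_diag (adjmx G))
      *m spectralmx (adjmx G).
  by rewrite -invmx_unitary //; apply/orthomx_spectralP/hermitian_normalmx.
exists (spectralmx (adjmx G)), (spectral_diag (adjmx G)); split => // [i|].
  exact/mxOverP/hermitian_spectral_diag_real.
apply: perm_eigenvalues; rewrite {1}defA char_poly_unitary_diag //.
by rewrite big_map_enum.
Qed.

Lemma size_eigenvalues (G : sgraph) : size (eigenvalues G) = gorder G.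
Proof.
have [P [d [_ _ _ /perm_size ->]]] := adjmx_spectral G.
by rewrite size_map size_enum_ord.
Qed.

Lemma eigenvalues_real (G : sgraph) (x : algC) :
  x \in eigenvalues G -> x \is Num.real.
Proof.
have [P [d [_ d_real _ /perm_mem ->]]] := adjmx_spectral G.
by case/mapP => i _ ->.
Qed.

Lemma sum_eigenvalues (G : sgraph) : \sum_(x <- eigenvalues G) x = 0.
Proof.
have [P [d [unitP _ defA eigG]]] := adjmx_spectral G.
rewrite (perm_big _ eigG) big_map_enum /=.
by rewrite -(mxtrace_unitary_diag d unitP) -defA mxtrace_adjmx.
Qed.

(** Puts the left copies before the right ones, whatever order the enumeration gives them, so that
    the adjacency matrix takes block form. *)
Definition Ebd_index (G : sgraph) (i : 'I_(gorder (Ebd G)))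
    : 'I_(gorder G + gorder G) :=
  unsplit match (enum_val i : G + G) with
          | inl x => inl (enum_rank x)
          | inr x => inr (enum_rank x)
          end.

Lemma Ebd_index_bij (G : sgraph) : bijective (@Ebd_index G).
Proof.
exists (fun j => enum_rank (match split j return Ebd G with
                            | inl x => inl (enum_val x)
                            | inr x => inr (enum_val x)
                            end)) => [i|j].
  rewrite /Ebd_index unsplitK; apply: (canLR (@enum_valK _)).
  by case: (enum_val i) => x; rewrite enum_rankK.
rewrite /Ebd_index enum_rankK -[RHS]splitK.
by case: (split j) => x; rewrite enum_valK.
Qed.

Lemma adjmx_Ebd (G : sgraph) :
  adjmx (Ebd G) = mxsub (@Ebd_index G) (@Ebd_index G)
    (block_mx 0 (adjmx G + 1%:M) (adjmx G + 1%:M) 0).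
Proof.
apply/matrixP => i j; rewrite [LHS]mxE [RHS]mxE /Ebd_index /=.
case: (enum_val i) => x; case: (enum_val j) => y /=;
  rewrite ?block_mxEul ?block_mxEur ?block_mxEdl ?block_mxEdr !mxE //.
all: rewrite !enum_rankK (inj_eq enum_rank_inj) ?(eq_sym y x) ?(adj_sym y x).
all: by have [->|_] := eqVneq x y; rewrite ?adj_irr ?add0r ?addr0.
Qed.

Lemma energy_Ebd (G : sgraph) :
  energy (Ebd G) = 2 * \sum_(x <- eigenvalues G) `|x + 1|.
Proof.
have [P [d [unitP _ defA eigG]]] := adjmx_spectral G.
pose e := d - const_mx (-1) : 'rV[algC]_(gorder G).
have defB : adjmx G + 1%:M = P^t* *m diag_mx e *m P.
  by rewrite /e -unitary_diag_shift // -defA -raddfN opprK.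
pose s := [seq e 0 i | i <- enum 'I_(gorder G)].
have /perm_eigenvalues eigEbd : char_poly (adjmx (Ebd G))
    = \prod_(x <- s ++ [seq - x | x <- s]) ('X - x%:P).
  rewrite adjmx_Ebd char_poly_relabel; last exact: Ebd_index_bij.
  rewrite char_poly_off_diag_block defB -[- _]mulNmx -mulmxN -raddfN /=.
  rewrite !char_poly_unitary_diag // big_cat /= (big_map -%R) !big_map_enum /=.
  by congr (_ * _); apply: eq_bigr => i _; rewrite mxE.
rewrite /energy (perm_big _ eigEbd) big_cat /= (perm_big _ eigG) /= (big_map -%R).
rewrite !big_map_enum; under [X in _ + X]eq_bigr do rewrite normrN.
rewrite mulrC mulrDr mulr1; congr (_ + _).
all: by apply: eq_bigr => i _; rewrite !mxE opprK.
Qed.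

Lemma gorder_Ebd (G : sgraph) : gorder (Ebd G) = (gorder G + gorder G)%N.
Proof. exact: card_sum. Qed.

(** * Complements, and incidence matrices of line graphs *)

Lemma adjmx_compl (G : sgraph) :
  adjmx (compl_graph G) = (const_mx 1)^T *m (const_mx 1 : 'rV_(gorder G))
    - 1%:M - adjmx G.
Proof.
apply/matrixP => i j; rewrite !mxE big_ord1 !mxE mulr1 /= /compl_adj.
rewrite (inj_eq enum_val_inj); have [->|_] := eqVneq i j.
  by rewrite adj_irr subr0 subrr.
by case: adj; rewrite /= ?subr0 ?subrr.
Qed.

Lemma edge_card2 (G : sgraph) (e : {set G}) : e \in edges G -> #|e| = 2%N.
Proof.
rewrite inE => /existsP[x /existsP[y /andP[xy /eqP ->]]].
by rewrite cards2; case: eqVneq xy => // ->; rewrite adj_irr.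
Qed.

Lemma gorder_line_graph (G : sgraph) : gorder (line_graph G) = gsize G.
Proof. by rewrite /gorder /= card_sig; apply: eq_card => e; rewrite !inE. Qed.

Lemma gsize_leq_bin (G : sgraph) : (gsize G <= 'C(gorder G, 2))%N.
Proof.
rewrite /gorder -cardsT -cards_draws; apply/subset_leq_card/subsetP => e eE.
by rewrite inE subsetT edge_card2.
Qed.

Definition incmx (G : sgraph) : 'M[algC]_(gorder (line_graph G), gorder G) :=
  \matrix_(i < gorder (line_graph G), j < gorder G)
    ((enum_val j : G) \in val (enum_val i : line_vertex G))%:R.

Lemma sum_enum_val (G : sgraph) (F : G -> algC) :
  \sum_(k < gorder G) F (enum_val k) = \sum_v F v.
Proof.
rewrite (reindex (@enum_rank G)); last exact/onW_bij/enum_rank_bij.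
by apply: eq_bigr => v _; rewrite enum_rankK.
Qed.

Lemma sum_indicator (T : finType) (A : {set T}) :
  \sum_v (v \in A)%:R = #|A|%:R :> algC.
Proof.
rewrite -sum1_card natr_sum [RHS]big_mkcond /=.
by apply: eq_bigr => v _; case: (v \in A).
Qed.

Lemma card_edgeI (G : sgraph) (e f : line_vertex G) :
  #|val e :&: val f| = ((e == f).*2 + line_adj e f)%N.
Proof.
rewrite /line_adj; have [->|neq_ef] /= := eqVneq e f.
  by rewrite setIid (edge_card2 (valP f)).
have : (#|val e :&: val f| < 2)%N.
  rewrite -(edge_card2 (valP e)) proper_card // properEneq subsetIl andbT.
  apply: contraNneq neq_ef => /setIidPl sub_ef; apply/eqP/val_inj/eqP.
  by rewrite eqEcard sub_ef !edge_card2 // ?(valP e) ?(valP f).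
by rewrite -card_gt0; case: #|_| => [|[]].
Qed.

(** An entry of the product counts common endpoints: two on the diagonal, one for distinct edges
    that meet. *)
Lemma incmx_mul_tr (G : sgraph) :
  incmx G *m (incmx G)^T = adjmx (line_graph G) - (-2)%:M.
Proof.
apply/matrixP => i j; rewrite mxE.
transitivity (#|val (enum_val i : line_vertex G)
                :&: val (enum_val j : line_vertex G)|%:R : algC).
  rewrite -sum_indicator -sum_enum_val; apply: eq_bigr => k _.
  by rewrite !mxE inE -natrM mulnb.
rewrite card_edgeI !mxE (inj_eq enum_val_inj) natrD addrC; congr (_ + _).
by case: (i == j); rewrite ?mulr1n ?opprK ?mulr0n ?oppr0.
Qed.

Lemma incmx_const (G : sgraph) :
  incmx G *m const_mx 1 = const_mx 2 :> 'cV_(gorder (line_graph G)).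
Proof.
apply/colP => i; rewrite !mxE -(edge_card2 (valP (enum_val i : line_vertex G))).
rewrite -sum_indicator -sum_enum_val; apply: eq_bigr => k _.
by rewrite !mxE mulr1.
Qed.

(** With B the incidence matrix, z B B^T = 0 forces |zB|^2 = 0, so zB = 0; now apply this to the
    constant vector, which B sends to the constant 2. *)
Lemma line_graph_eigenspace_ortho (G : sgraph)
    (z : 'rV[algC]_(gorder (line_graph G))) :
  z *m (adjmx (line_graph G) - (-2)%:M) = 0 -> z *m (const_mx 1)^T = 0 :> 'M_1.
Proof.
rewrite -incmx_mul_tr => zB.
have zB0 : z *m incmx G = 0.
  have : ((z *m incmx G) *m (z *m incmx G)^t*) 0 0 = 0.
    rewrite trmx_mul map_mxM mulmxA.
    have -> : (incmx G)^t* = (incmx G)^T.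
      by apply/matrixP => i j; rewrite !mxE conjC_nat.
    by rewrite -(mulmxA z) zB mul0mx mxE.
  by rewrite -dotmxE => /eqP; rewrite dnorm_eq0 => /eqP.
have : z *m const_mx 2 = 0 :> 'M_1 by rewrite -incmx_const mulmxA zB0 mul0mx.
move/matrixP/(_ 0 0); rewrite !mxE => sum0.
apply/matrixP => i j; rewrite !mxE !ord1.
apply/eqP; rewrite -(mulIr_eq0 _ (@mulIf _ (2 : algC) _)) ?pnatr_eq0 //.
rewrite mulr_suml -{2}sum0; apply/eqP; apply: eq_bigr => k _.
by rewrite !mxE mulr1.
Qed.

(** * The spectrum of the complement *)

Lemma count_map_enum (I : finType) (J : Type) (h : I -> J) (p : pred J) :
  count p [seq h i | i <- enum I] = #|[pred i | p (h i)]|.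
Proof.
rewrite -sum1_count big_mkcond big_map_enum -sum1_card [RHS]big_mkcond.
exact: eq_bigr.
Qed.

Lemma perm_almost_const (T : eqType) (a : T) (q : nat) (s : seq T) :
    size s = q.+1 -> (q <= count_mem a s)%N ->
  exists b, perm_eq s (b :: nseq q a).
Proof.
move=> size_s q_le; have /permPl perm_s := perm_filterC (pred1 a) s.
have filter_s : filter (pred1 a) s = nseq (count_mem a s) a.
  by rewrite -size_filter; apply/all_pred1P/filter_all.
have := perm_size perm_s; rewrite size_cat filter_s size_nseq size_s.
move: perm_s; rewrite filter_s; case: (filter _ _) => [|b []] /=.
(* Here all q + 1 entries equal [a], so the leftover one is [a] too. *)
- rewrite addn0 cats0 => perm_s eq_q; exists a.
  by rewrite perm_sym; move: perm_s; rewrite eq_q.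
- rewrite addn1 => perm_s [eq_q]; exists b.
  by rewrite perm_sym -eq_q -cat1s perm_catC.
- move=> x l _; rewrite 2!addnS => -[eq_q].
  by move: q_le; rewrite -eq_q ltnNge leq_addr.
Qed.

Lemma kermx_ortho_const (G : sgraph) (a : algC) :
  (forall z : 'rV[algC]_(gorder G),
     z *m (adjmx G - a%:M) = 0 -> z *m (const_mx 1)^T = 0 :> 'M_1) ->
  kermx (adjmx G - a%:M) *m (const_mx 1 : 'rV_(gorder G))^T = 0.
Proof.
move=> ortho; apply/row_matrixP => i; rewrite row_mul row0 ortho //.
by apply/sub_kermxP; rewrite row_sub.
Qed.

(* The eigenspace K of -2 stays an eigenspace, for the eigenvalue 1, of the   *)
(* complement. On the sum of K and the line of constant vectors the           *)
(* complement is positive semidefinite, and on its orthogonal, where A is     *)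
(* positive semidefinite, the complement acts as -1 - A.                      *)
Lemma compl_eigenvalues (G : sgraph) (q := eigenvalue_mult G (-2)) :
    property_rho G -> (0 < gorder G)%N ->
    (forall z : 'rV[algC]_(gorder G),
       z *m (adjmx G - (-2)%:M) = 0 -> z *m (const_mx 1)^T = 0 :> 'M_1) ->
  exists (b : algC) (r : seq algC),
    [/\ perm_eq (eigenvalues (compl_graph G)) (b :: nseq q 1 ++ r), 0 <= b &
        forall x, x \in r -> x <= -1].
Proof.
move=> rhoG G_gt0 ortho.
have [P [d [unitP d_real defA eigA]]] := adjmx_spectral G.
have [Q [e [unitQ e_real defB eigB]]] := adjmx_spectral (compl_graph G).
set n := gorder G in P d unitP d_real defA eigA ortho G_gt0 *.
rewrite -/(gorder G) -/n in Q e unitQ e_real defB eigB.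
set A := adjmx G in defA ortho; pose u : 'rV[algC]_n := const_mx 1.
pose B : 'M[algC]_n := u^T *m u - 1%:M - A.
have {}defB : B = Q^t* *m diag_mx e *m Q by rewrite -defB adjmx_compl.
have utC : u^t* = u^T by apply/matrixP => i j; rewrite !mxE conjC1.
have BtC : B^t* = B by rewrite /B -adjmx_compl; exact: (adjmx_trC (compl_graph G)).
set K := kermx (A - (-2)%:M).
have Ku : K *m u^T = 0 by apply: kermx_ortho_const.
have KA : K *m A = -2 *: K.
  have /eqP := mulmx_ker (A - (-2)%:M).
  by rewrite -/K mulmxBr mul_mx_scalar subr_eq0 => /eqP.
have rankK : \rank K = q.
  rewrite /K defA mxrank_ker_unitary_diag // /q /eigenvalue_mult.
  by rewrite (permP eigA) count_map_enum; apply: eq_card => i; rewrite !inE.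
have zu (z : 'rV_n) : (z <= K)%MS -> z *m u^T = 0.
  by case/submxP => w ->; rewrite -mulmxA Ku mulmx0.
(* On K the all-ones matrix vanishes and A acts as -2, so B acts as -1 + 2 = 1. *)
have zB (z : 'rV_n) : (z <= K)%MS -> z *m B = z.
  move=> zK; rewrite /B !mulmxBr mulmxA zu // mul0mx sub0r mulmx1.
  case/submxP: zK => w ->; rewrite -mulmxA KA -scalemxAr scaleNr opprK.
  by rewrite scaler_nat mulr2n addKr.
pose M := (K + u)%MS.
have rankM : \rank M = q.+1.
  apply/eqP; rewrite eqn_leq -rankK; apply/andP; split.
    rewrite (leq_trans (mxrank_adds_leqif K u)) // -[(\rank K).+1]addn1 leq_add2l.
    exact: rank_leq_row.
  have : (K < M)%MS.
    rewrite ltmxE addsmxSl; apply/negP => /(submx_trans (addsmxSr K u)) /zu.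
    move/matrixP/(_ 0 0); rewrite !mxE.
    under eq_bigr do rewrite !mxE mulr1.
    by rewrite sumr_const card_ord => /eqP; rewrite pnatr_eq0 eqn0Ngt G_gt0.
  by rewrite ltmxErank => /andP[].
have cnt1 : (q <= count_mem 1%R (eigenvalues (compl_graph G)))%N.
  rewrite (permP eigB) count_map_enum -rankK.
  rewrite (leq_trans (mxrankS (_ : K <= kermx (B - 1%:M))%MS)) //.
    apply/row_subP => i; apply/sub_kermxP.
    by rewrite mulmxBr mulmx1 zB ?row_sub ?subrr.
  by rewrite defB mxrank_ker_unitary_diag.
have cnt_ge0 : (q < count (fun x => 0 <= x)%R (eigenvalues (compl_graph G)))%N.
  rewrite (permP eigB) count_map_enum -rankM.
  apply: (inertia_ge unitQ) => // x; rewrite -defB mul0r.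
  case/sub_addsmxP => -[c1 c2] /= ->; set z := c1 *m K.
  have zK : (z <= K)%MS by apply: submxMl.
  rewrite [c2]mx11_scalar mul_scalar_mx; set c := c2 0 0.
  have Bz : B *m z^t* = z^t* by rewrite -{1}BtC -map_mxM -trmx_mul zB.
  have uz : u *m z^t* = 0.
    by rewrite -(trmxCK u) -map_mxM -trmx_mul utC zu // trmx0 map_mx0.
  (* Mixed terms vanish because B fixes [z], which is orthogonal to [u]. The remaining u B u^T is
     the sum of the entries of an adjacency matrix, hence nonnegative. *)
  have -> : (z + c *: u) *m B *m (z + c *: u)^t*
          = z *m z^t* + `|c| ^+ 2 *: (u *m B *m u^T).
    have -> : (z + c *: u)^t* = z^t* + c^* *: u^T.
      by rewrite -utC; apply/matrixP => i j; rewrite !mxE rmorphD rmorphM.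
    rewrite mulmxDl zB // mulmxDr !mulmxDl -!scalemxAl -mulmxA Bz uz scaler0.
    by rewrite addr0 -!scalemxAr zu // scaler0 add0r scalerA normCK.
  rewrite mxE [X in _ + X]mxE -dotmxE addr_ge0 ?dnorm_ge0 //.
  rewrite mulr_ge0 ?exprn_ge0 // mxE sumr_ge0 // => j _.
  rewrite [u^T _ _]mxE [u _ _]mxE mulr1 mxE sumr_ge0 // => i _.
  by rewrite [u _ _]mxE mul1r /B -adjmx_compl mxE ler0n.
have cnt_le : (n - q.+1 <= count (fun x => x <= -1)%R (eigenvalues (compl_graph G)))%N.
  rewrite (permP eigB) count_map_enum.
  (* The Hermitian orthogonal of [M]. *)
  pose W := kermx (M^t*).
  have <- : \rank W = (n - q.+1)%N.
    by rewrite mxrank_ker mxrank_map mxrank_tr rankM.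
  apply: (inertia_le unitQ) => // [|x]; first by rewrite realN real1.
  rewrite -defB => /sub_kermxP xM.
  have x_ortho (y : 'rV_n) : (y <= M)%MS -> x *m y^t* = 0.
    by case/submxP => w ->; rewrite trmx_mul map_mxM mulmxA xM mul0mx.
  (* By property rho a negative eigenvalue is -2, so its eigenvector lies in K and [x] has no
     component along it. *)
  have formA : 0 <= (x *m A *m x^t*) 0 0.
    rewrite defA unitary_diag_form sumr_ge0 // => i _.
    have [d_ge0|d_lt0] := real_ge0P (d_real i).
      by rewrite mulr_ge0 ?exprn_ge0.
    have d_eig : d 0 i \in eigenvalues G.
      by rewrite (perm_mem eigA) map_f ?mem_enum.
    have rowK : (row i P <= K)%MS.
      apply/sub_kermxP; rewrite mulmxBr mul_mx_scalar defA unitary_diag_row //.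
      by rewrite (rhoG _ d_eig d_lt0) subrr.
    have := x_ortho _ (submx_trans rowK (addsmxSl _ _)).
    move/matrixP/(_ 0 0); rewrite [RHS]mxE => xP0.
    rewrite (_ : (x *m P^t*) 0 i = 0) ?normr0 ?expr0n ?mulr0 //.
    by rewrite -[RHS]xP0 !mxE; apply: eq_bigr => j _; rewrite !mxE.
  rewrite /B !mulmxBr mulmxA -utC x_ortho ?addsmxSr // mul0mx sub0r mulmx1.
  by rewrite mulmxBl mulNmx mxE mulN1r [X in X + _]mxE [X in _ + X]mxE gerDl oppr_le0.
set t := eigenvalues _ in eigB cnt1 cnt_ge0 cnt_le *.
pose p (x : algC) := 0 <= x.
have size_t : size t = n by rewrite size_eigenvalues.
have le_p (x : algC) : x <= -1 -> ~~ p x.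
  by move=> x_le; apply/negP => /le_trans/(_ x_le); rewrite oppr_ge0 ler10.
have cnt_sub : (count (fun x : algC => x <= -1)%R t <= count (predC p) t)%N.
  exact: sub_count.
have cnt_split := count_predC p t; rewrite size_t in cnt_split.
(* The lower bounds q + 1 and n - (q + 1) concern disjoint ranges of eigenvalues and together
   exhaust n, so both are equalities. *)
have cnt_p : count p t = q.+1.
  apply/eqP; rewrite eqn_leq cnt_ge0 andbT -(leq_add2r (count (predC p) t)).
  by rewrite cnt_split -leq_subLR (leq_trans cnt_le).
have [b perm_b] : exists b, perm_eq (filter p t) (b :: nseq q 1).
  apply: perm_almost_const; first by rewrite size_filter.
  rewrite (leq_trans cnt1) // count_filter; apply: sub_count => x /= /eqP ->.
  by rewrite /p eqxx ler01.
exists b, (filter (predC p) t); split.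
- by rewrite -(perm_filterC p t) -cat_cons perm_cat2r.
- have : b \in filter p t by rewrite (perm_mem perm_b) mem_head.
  by rewrite mem_filter => /andP[].
- apply/allP; rewrite all_count size_filter count_filter.
  rewrite (@eq_count _ _ (fun x : algC => x <= -1)%R) => [|x /=]; last first.
    exact/andb_idr/le_p.
  rewrite eqn_leq cnt_sub (leq_trans _ cnt_le) //.
  by rewrite -cnt_split cnt_p addKn.
Qed.

(** * Largest eigenvalue and energies *)

(** The order of [algC] is only partial; an upper bound that belongs to the list is comparable to
    every entry, which suffices. *)
Lemma bigmax_mem (s : seq algC) (x0 m : algC) :
    m \in x0 :: s -> (forall x, x \in x0 :: s -> x <= m) ->
  \big[Num.max/x0]_(x <- s) x = m.
Proof.
have big_le t : x0 <= m -> (forall x, x \in t -> x <= m) ->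
    \big[Num.max/x0]_(x <- t) x <= m.
  elim: t => [|a t IHt] x0m tm; first by rewrite big_nil.
  rewrite big_cons /Num.max; case: ifP => _; last by rewrite tm ?mem_head.
  by apply: IHt => // x xt; rewrite tm // inE xt orbT.
elim: s => [|a s IHs] ms le_m.
  by move: ms; rewrite big_nil inE => /eqP.
have x0m : x0 <= m by rewrite le_m ?mem_head.
have am : a <= m by rewrite le_m // !inE eqxx orbT.
have sm x : x \in s -> x <= m by move=> xs; rewrite le_m // !inE xs !orbT.
rewrite big_cons; have [eq_am|neq_am] := eqVneq a m.
  by rewrite eq_am max_l // big_le.
rewrite IHs ?max_r // => [|x]; last first.
  by rewrite inE => /predU1P[->//|/sm].
by move: ms; rewrite !inE eq_sym (eq_sym m a) (negPf neq_am) eq_sym.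
Qed.

Lemma largest_eigenvalueE (G : sgraph) (m : algC) :
    m \in eigenvalues G -> (forall x, x \in eigenvalues G -> x <= m) ->
  largest_eigenvalue G = m.
Proof.
rewrite /largest_eigenvalue; case: (eigenvalues G) => [//|a s] ms le_m.
(* The default value of the maximum is the first eigenvalue, so it adds no new candidate. *)
have mem_s : a :: a :: s =i a :: s by move=> x; rewrite !inE orbA orbb.
by apply: bigmax_mem => [|x]; rewrite mem_s //; apply: le_m.
Qed.

(** On the spectrum |x + 1| = x + 1 + 2[x = -2], and the eigenvalues sum to zero. *)
Lemma energy_Ebd_rho (G : sgraph) : property_rho G ->
  energy (Ebd G) = 2 * ((gorder G)%:R + 2 * (eigenvalue_mult G (-2))%:R).
Proof.
move=> rhoG; rewrite energy_Ebd; congr (_ * _).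
rewrite -size_eigenvalues /eigenvalue_mult -sum1_size -sum1_count !natr_sum.
rewrite [X in _ + _ * X]big_mkcond mulr_sumr -big_split /=.
rewrite -[RHS]addr0 -[X in _ + X](sum_eigenvalues G) -big_split /=.
apply: eq_big_seq => x xG; have [x_ge0|x_lt0] := real_ge0P (eigenvalues_real xG).
  rewrite ger0_norm ?addr_ge0 //; case: eqVneq x_ge0 => [->|_ _].
    by rewrite oppr_ge0 lern0.
  by rewrite mulr0 addr0 addrC.
rewrite (rhoG x xG x_lt0) eqxx.
by rewrite (_ : -2 + 1 = -1 :> algC); [rewrite normrN1; ring | ring].
Qed.

Section SpectrumWithOnes.

Variables (G : sgraph) (b : algC) (q : nat) (r : seq algC).
Hypothesis perm_G : perm_eq (eigenvalues G) (b :: nseq q 1 ++ r).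
Hypotheses (b_ge0 : 0 <= b) (r_le : forall x, x \in r -> x <= -1).

Lemma size_spectrum_ones : gorder G = (q + size r).+1.
Proof.
by rewrite -size_eigenvalues (perm_size perm_G) /= size_cat size_nseq.
Qed.

Lemma num_neg_spectrum_ones : num_neg_eigenvalues G = size r.
Proof.
rewrite /num_neg_eigenvalues (permP perm_G) /= count_cat count_nseq.
rewrite ltr10 le_gtF // !add0n; apply/eqP; rewrite -all_count.
by apply/allP => x /r_le /le_lt_trans -> //; rewrite oppr_lt0 ltr01.
Qed.

(** The vanishing trace eliminates [r], whose sum is -b - q. *)
Lemma energy_Ebd_spectrum_ones :
  energy (Ebd G) = 2 * (2 * b + 1 + 3 * q%:R - (size r)%:R).
Proof.
have := sum_eigenvalues G; rewrite energy_Ebd !(perm_big _ perm_G) /=.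
rewrite !big_cons !big_cat /= !big_nseq !iter_addr_0 => sum0.
have -> : \sum_(x <- r) `|x + 1| = - \sum_(x <- r) x - (size r)%:R.
  rewrite -sum1_size natr_sum -sumrN -sumrB; apply: eq_big_seq => x /r_le x_le.
  by rewrite ler0_norm ?opprD // -lerBrDr sub0r.
have -> : \sum_(x <- r) x = - b - q%:R by rewrite -[RHS]addr0 -[X in _ = _ + X]sum0; ring.
have -> : `|1 + 1 : algC| = 2 by rewrite ger0_norm ?addr_ge0.
by rewrite ger0_norm ?addr_ge0 //; congr (2 * _); rewrite -mulr_natr; ring.
Qed.

Lemma largest_spectrum_ones :
  largest_eigenvalue G = if (0 < q)%N && (b < 1) then 1 else b.
Proof.
have memG x : (x \in eigenvalues G)
    = [|| x == b, (0 < q)%N && (x == 1) | x \in r].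
  by rewrite (perm_mem perm_G) inE mem_cat mem_nseq.
have r_lt0 x : x \in r -> x <= 0.
  by move/r_le/le_trans; apply; rewrite oppr_le0 ler01.
have [/andP[q_gt0 b_lt1]|b_max] := ifP; apply: largest_eigenvalueE => [|x].
- by rewrite memG q_gt0 eqxx orbT.
- rewrite memG => /or3P[/eqP->|/andP[_ /eqP->]//|/r_lt0/le_trans->//].
  exact: ltW.
- by rewrite memG eqxx.
rewrite memG => /or3P[/eqP->//|/andP[q_gt0 /eqP->]|/r_lt0/le_trans->//].
by rewrite real_leNgt ?real1 ?ger0_real //; move: b_max; rewrite q_gt0 => /= ->.
Qed.

End SpectrumWithOnes.

Theorem theorem6p5 (G : sgraph) (k : nat) (hk : (1 <= k)%N)
    (hrho : property_rho (iter_line_graph k G))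
    (hmult : (eigenvalue_mult (iter_line_graph k G) (-2))%:Z =
             (gsize (iter_line_graph k.-1 G))%:Z
             - (gorder (iter_line_graph k.-1 G))%:Z) :
  equienergetic (Ebd (iter_line_graph k G))
                (Ebd (compl_graph (iter_line_graph k G)))
  <-> largest_eigenvalue (compl_graph (iter_line_graph k G)) =
      (num_neg_eigenvalues (compl_graph (iter_line_graph k G)))%:R.
Proof.
case: k hk hrho hmult => [//|k] _.
rewrite /iter_line_graph iterS /= -/(iter_line_graph k G).
set X := iter_line_graph k G; set H := line_graph X => rhoH multH.
have eq_order : gorder (Ebd H) = gorder (Ebd (compl_graph H)).
  by rewrite !gorder_Ebd.
(* Without vertices both energies are 0, and the default largest eigenvalue 0 equals the empty
   count. *)
have [H0|H_gt0] := posnP (gorder H).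
  have eig0 Y : gorder Y = 0%N -> eigenvalues Y = [::].
    by move=> Y0; apply: size0nil; rewrite size_eigenvalues.
  have eigC0 : eigenvalues (compl_graph H) = [::] by apply: eig0.
  rewrite /largest_eigenvalue /num_neg_eigenvalues eigC0 big_nil.
  split=> _; [by [] | split; first exact: eq_order].
  by rewrite (energy_Ebd H) (energy_Ebd (compl_graph H)) eigC0 eig0.
have [b [r [eigH b_ge0 r_le]]] :=
  compl_eigenvalues rhoH H_gt0 (@line_graph_eigenspace_ortho X).
set q := eigenvalue_mult H (-2) in multH eigH.
have orderH : gorder H = (q + size r).+1 := size_spectrum_ones eigH.
have orderX : gorder X = (size r).+1.
  have : q%:Z + (gorder X)%:Z = (gsize X)%:Z by rewrite multH subrK.
  rewrite -gorder_line_graph orderH -PoszD => -[/eqP].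
  by rewrite -addnS eqn_add2l => /eqP.
(* X has q + |r| + 1 edges on |r| + 1 vertices; for q > 0 this exceeds the binomial bound when |r|
   is 0 or 1. *)
have r_gt1 : (0 < q)%N -> (1 < size r)%N.
  move=> q_gt0; have := gsize_leq_bin X.
  rewrite -gorder_line_graph orderH orderX.
  case: (size r) => [|[|//]]; first by rewrite bin_small.
  by rewrite binn; case: (q) q_gt0.
rewrite (largest_spectrum_ones eigH b_ge0 r_le).
rewrite (num_neg_spectrum_ones eigH b_ge0 r_le).
have energyE : energy (Ebd H) = energy (Ebd (compl_graph H)) <-> b = (size r)%:R.
  rewrite (energy_Ebd_rho rhoH) (energy_Ebd_spectrum_ones eigH b_ge0 r_le).
  rewrite -/q orderH.
  split=> [eqE|->]; last by rewrite -addn1 !natrD; ring.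
  (* The two energies differ by exactly 4(b - |r|). *)
  apply: (@mulfI _ (4 : algC)); first by rewrite pnatr_eq0.
  apply/eqP; rewrite -subr_eq0; apply/eqP; move/eqP: eqE.
  rewrite -addn1 !natrD eq_sym -subr_eq0 => /eqP eqE; rewrite -[RHS]eqE.
  ring.
rewrite -/H; apply: (iff_trans (B := b = (size r)%:R)).
  by split=> [[_ /energyE]|/energyE eqE]; [ | split].
(* If 1 is the largest eigenvalue and b < 1, both sides are false, since |r| is at least 2. *)
case: ifP => // /andP[/r_gt1 r_big b_lt1]; split=> [bE|/esym/eqP].
  by move: b_lt1; rewrite bE ltrn1; case: (size r) r_big.
by rewrite pnatr_eq1; case: (size r) r_big => [|[]].
Qed.
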